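(* Let $Y\subseteq\mathbb{C}^n$ be an affine toric variety, and identify $\mathbb{C}^n$ with the space of diagonal $n\times n$ complex matrices. Then there exists a diagonal matrix $M\in\operatorname{GL}_n(\mathbb{C})$ such that $Y=\overline{\langle M\rangle}$, where $\langle M\rangle=\{M^k\mid k\in\mathbb{Z}\}$ and the Zariski closure is taken in $\mathbb{C}^n$.
   Context: Here an affine toric variety $Y\subseteq\mathbb{C}^n$ is an embedded one defined by lattice points $\alpha_1,\dots,\alpha_n\in\mathbb{Z}^r$ (for some $r$; repetitions allowed): $Y$ is the Zariski closure in $\mathbb{C}^n$ of the image of the monomial map $(\mathbb{C}^* )^r\to(\mathbb{C}^* )^n$, $x=(x_1,\dots,x_r)\mapsto(x^{\alpha_1},\dots,x^{\alpha_n})$, where $x^{\alpha_i}=x_1^{\alpha_{i1}}\cdots x_r^{\alpha_{ir}}$. *)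

(* Defs.v *)
From HB Require Import structures.
From mathcomp Require Import all_boot all_order all_algebra.
From mathcomp Require Import mpoly.
From mathcomp Require Import boolp classical_sets reals.
From mathcomp Require Import complex.

Set Implicit Arguments.
Unset Strict Implicit.
Unset Printing Implicit Defensive.

Import GRing.Theory.
Local Open Scope classical_set_scope.
Local Open Scope ring_scope.

(* Points of affine n-space over F are row vectors 'rV[F]_n. *)
Section Zariski.
Variables (F : fieldType) (n : nat).

Definition zero_locus (P : set {mpoly F[n]}) : set 'rV[F]_n :=
  [set x : 'rV[F]_n | forall p, P p -> p.@[x 0] = 0].

Definition zariski_closed (A : set 'rV[F]_n) : Prop :=
  exists P : set {mpoly F[n]}, A = zero_locus P.

Definition zariski_closure (S : set 'rV[F]_n) : set 'rV[F]_n :=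
  smallest zariski_closed S.

End Zariski.

Section Toric.
Variables (F : fieldType) (n : nat).

Definition torus (r : nat) : set 'rV[F]_r := [set x : 'rV[F]_r | forall j, x 0 j != 0].

(* Row i of alpha is the exponent vector alpha_i. *)
Definition monomial_map (r : nat) (alpha : 'M[int]_(n, r)) (x : 'rV[F]_r) :
  'rV[F]_n := \row_(i < n) \prod_(j < r) x 0 j ^ alpha i j.

Definition affine_toric_variety (Y : set 'rV[F]_n) : Prop :=
  exists (r : nat) (alpha : 'M[int]_(n, r)),
    Y = zariski_closure (monomial_map alpha @` @torus r).

End Toric.

Section Powers.
Variables (F : fieldType) (n : nat).

(* The library's integer power needs a unitRingType, which 'M[F]_n is only
   when n is syntactically a successor. *)
Definition mxpowz (M : 'M[F]_n) (k : int) : 'M[F]_n :=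
  match k with
  | Posz m => M ^+ m
  | Negz m => invmx M ^+ m.+1
  end.

(* The elements of <M>, for M diagonal, seen in affine n-space through the
   identification diag_mx of vectors with diagonal matrices. *)
Definition diag_cyclic (M : 'M[F]_n) : set 'rV[F]_n :=
  [set x : 'rV[F]_n | exists k : int, diag_mx x = mxpowz M k].

End Powers.

(* Main.v *)
Require Import Defs.
From mathcomp Require Import all_boot all_order all_algebra.
From mathcomp Require Import mpoly.
From mathcomp Require Import boolp classical_sets reals.
From mathcomp Require Import complex.

(** Take M to be the image, under the monomial map, of a point t of the torus
    whose coordinates are distinct primes. If a polynomial with coefficients
    [c_m] vanishes on all powers of M, then [\sum_m c_m (t^(e m))^k = 0] for
    every natural k, where [e m] is the exponent of the m-th monomial pulled
    back to the torus; hence [\sum_m c_m q(t^(e m)) = 0] for every univariate q.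
    For x in the torus, [t^(e m)] determines [e m] by unique factorization, so
    some q interpolates [t^(e m) |-> x^(e m)], and the polynomial vanishes at
    the image of x. *)

Import GRing.Theory Num.Theory.
Local Open Scope classical_set_scope.
Local Open Scope ring_scope.

(** Induction on [s]. If [f a] is already a node, the hypothesis makes the old [q] correct at [a];
    otherwise add a multiple of [w], which vanishes at the old nodes but not at [f a]. *)
Lemma interpolation_seq (F : fieldType) (T : eqType) (f g : T -> F) (s : seq T) :
    (forall x y, f x = f y -> g x = g y) ->
  exists q : {poly F}, {in s, forall x, q.[f x] = g x}.
Proof.
move=> fg; elim: s => [|a s [q qs]]; first by exists 0.
have [/mapP[b bs fab]|fa] := boolP (f a \in map f s).
  exists q => x; rewrite inE => /predU1P[->|/qs//].
  by rewrite fab qs //; apply: fg.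
pose w := \prod_(y <- map f s) ('X - y%:P).
have wa : w.[f a] != 0 by rewrite -[_ == 0]/(root w (f a)) root_prod_XsubC.
exists (q + ((g a - q.[f a]) / w.[f a]) *: w) => x; rewrite inE.
move=> /predU1P[->|xs]; first by rewrite !hornerE divfK // subrKC.
have /rootP wx : root w (f x) by rewrite root_prod_XsubC map_f.
by rewrite hornerD hornerZ wx mulr0 addr0 qs.
Qed.

Lemma sum_exp_eq0_transfer (F : fieldType) (T : eqType) (c f g : T -> F)
    (s : seq T) :
    (forall x y, f x = f y -> g x = g y) ->
    (forall k : nat, \sum_(x <- s) c x * f x ^+ k = 0) ->
  \sum_(x <- s) c x * g x = 0.
Proof.
move=> fg cf; have [q qs] := interpolation_seq F T f g s fg.
rewrite (eq_big_seq (fun x => \sum_(k < size q) q`_k * (c x * f x ^+ k))).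
  by rewrite exchange_big big1 // => k _; rewrite -mulr_sumr cf mulr0.
move=> x xs; rewrite -qs // horner_coef mulr_sumr.
by apply: eq_bigr => k _; rewrite mulrCA.
Qed.

Lemma logn_prod_primes (r : nat) (p a : 'I_r -> nat) (i : 'I_r) :
    injective p -> (forall j, prime (p j)) ->
  logn (p i) (\prod_j p j ^ a j)%N = a i.
Proof.
move=> p_inj p_prime; rewrite (bigD1 i) //= lognM ?expn_gt0 ?(prime_gt0 (p_prime i)) //.
  rewrite pfactorK // logn_coprime ?addn0 //.
  apply: (big_ind (coprime (p i))) => [|x y|j ji]; first exact: coprimen1.
    by rewrite coprimeMr => -> ->.
  apply: coprimeXr; rewrite prime_coprime // dvdn_prime2 //.
  by apply: contra ji => /eqP/p_inj ->.
by apply: prodn_cond_gt0 => j _; rewrite expn_gt0 prime_gt0.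
Qed.

(** Clearing negative exponents gives an equality of natural numbers, which holds in the naturals
    since the characteristic is 0; valuations then compare exponents. *)
Lemma prod_primes_exprz_inj (F : numFieldType) (r : nat) (p : 'I_r -> nat)
    (e e' : 'I_r -> int) :
    injective p -> (forall j, prime (p j)) ->
    \prod_j (p j)%:R ^ e j = \prod_j (p j)%:R ^ e' j :> F ->
  e =1 e'.
Proof.
move=> p_inj p_prime ee'.
have p0 j : (p j)%:R != 0 :> F by rewrite pnatr_eq0 -lt0n prime_gt0.
(* [a] and [b] are the positive and negative parts of [e - e']. *)
pose a j := if e j - e' j is Posz m then m else 0%N.
pose b j := if e j - e' j is Negz m then m.+1 else 0%N.
have abE j : (p j)%:R ^ (e j) * (p j)%:R ^+ b j =
             (p j)%:R ^ (e' j) * (p j)%:R ^+ a j :> F.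
  rewrite -[e j](subrK (e' j)) addrC expfzDr // -mulrA; congr (_ * _).
  rewrite /a /b; case: (e j - e' j) => m /=; first by rewrite expr0 mulr1.
  by rewrite expr0 NegzE -exprnN mulVf // expf_neq0.
have abprod : (\prod_j p j ^ a j = \prod_j p j ^ b j)%N.
  apply/eqP; rewrite -(eqr_nat F) !natr_prod; apply/eqP.
  have P0 : \prod_j (p j)%:R ^ e j != 0 :> F.
    by apply/prodf_neq0 => j _; rewrite expfz_neq0.
  apply: (mulfI P0); rewrite {1}ee' -!big_split /=.
  by apply: eq_bigr => j _; rewrite !natrX abE.
move=> i; have := logn_prod_primes r p a i p_inj p_prime.
rewrite abprod logn_prod_primes // /a /b => abi.
(* The two parts are equal and never both nonzero, so both vanish. *)
by apply/eqP; rewrite -subr_eq0; case: (e i - e' i) abi => [m <-|].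
Qed.

Lemma exists_distinct_primes (r : nat) :
  exists p : 'I_r -> nat, injective p /\ forall j, prime (p j).
Proof.
pose next m := s2val (prime_above m).
have next_gt m : (m < next m)%N by rewrite /next; case: prime_above.
have next_inj : injective (fun k => iter k next 0%N).
  apply: incn_inj; apply: leq_mono; apply: homo_ltn; first exact: ltn_trans.
  by move=> k; exact: next_gt.
(* The shift to [j.+1] skips the starting value 0, which is not prime. *)
exists (fun j => iter j.+1 next 0%N); split=> [i j /next_inj[]/val_inj//|j].
by rewrite iterS /next; case: prime_above.
Qed.

(** Polynomials cutting out a closed set that contains [B] also vanish on [A], so [A] and [B] lie in
    the same closed sets. *)
Lemma zariski_closure_eq (F : fieldType) (n : nat) (A B : set 'rV[F]_n) :
    B `<=` A ->
    (forall q : {mpoly F[n]}, (forall x, B x -> q.@[x 0] = 0) ->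
       forall x, A x -> q.@[x 0] = 0) ->
  zariski_closure A = zariski_closure B.
Proof.
move=> BA AB; apply/seteqP; split=> x xcl Z [Zcl sZ]; apply: xcl; split=> //.
  case: Zcl sZ => P -> BP y Ay q Pq.
  by apply: AB Ay => z /BP; apply.
exact: subset_trans BA sZ.
Qed.

Lemma mxpowz_diag (F : fieldType) (n : nat) (v : 'rV[F]_n) (k : int) :
    torus v ->
  mxpowz (diag_mx v) k = diag_mx (\row_i v 0 i ^ k).
Proof.
move=> v0.
have diagX (w : 'rV[F]_n) m : diag_mx w ^+ m = diag_mx (\row_i w 0 i ^+ m).
  elim: m => [|m IHm].
    by apply/matrixP => i j; rewrite expr0 !mxE.
  rewrite exprS IHm -[LHS]/(_ *m _) mulmx_diag; congr diag_mx.
  by apply/rowP => i; rewrite !mxE exprS.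
have diagV : invmx (diag_mx v) = diag_mx (\row_i (v 0 i)^-1).
  have vV : diag_mx v *m diag_mx (\row_i (v 0 i)^-1) = 1%:M.
    rewrite mulmx_diag -diag_const_mx; congr diag_mx.
    by apply/rowP => i; rewrite !mxE mulfV.
  have [vU _] := mulmx1_unit vV.
  by rewrite -[RHS](mulKmx vU) vV mulmx1.
case: k => m /=; first exact: diagX.
rewrite diagV diagX; congr diag_mx; apply/rowP => i.
by rewrite !mxE NegzE exprVn -exprnN.
Qed.

Section MonomialMap.
Variables (F : fieldType) (n r : nat) (alpha : 'M[int]_(n, r)).

Lemma monomial_map_torus (x : 'rV[F]_r) :
  torus x -> torus (monomial_map alpha x).
Proof.
by move=> x0 i; rewrite mxE; apply/prodf_neq0 => j _; rewrite expfz_neq0.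
Qed.

Lemma monomial_map_exprz (x : 'rV[F]_r) (k : int) :
  monomial_map alpha (\row_j x 0 j ^ k) = \row_i monomial_map alpha x 0 i ^ k.
Proof.
apply/rowP => i; rewrite !mxE.
rewrite (big_morph (fun y => y ^ k) (fun y z => expfzMl y z k) (exp1rz _ k)).
by apply: eq_bigr => j _; rewrite mxE !exprz_exp mulrC.
Qed.

(** The exponent on the right is the transpose of [alpha] applied to [m]: this is the pullback of
    the monomial to the torus. *)
Lemma monomial_map_mmap1 (x : 'rV[F]_r) (m : 'X_{1..n}) : torus x ->
  \prod_i monomial_map alpha x 0 i ^+ m i =
  \prod_j x 0 j ^ (\sum_i alpha i j * (m i)%:Z).
Proof.
move=> x0; under eq_bigr => i _ do rewrite mxE -prodrXl.
rewrite exchange_big; apply: eq_bigr => j _.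
rewrite (big_morph _ (fun a b => expfzDr a b (x0 j)) (expr0z _)).
by apply: eq_bigr => i _; rewrite -exprz_exp.
Qed.

End MonomialMap.

Theorem proposition14 (R : realType) (n : nat) (Y : set 'rV[R[i]]_n) :
  affine_toric_variety Y ->
  exists M : 'M[R[i]]_n,
    [/\ is_diag_mx M, M \in unitmx & Y = zariski_closure (diag_cyclic M)].
Proof.
move=> [r [alpha ->]].
have [p [p_inj p_prime]] := exists_distinct_primes r.
pose t : 'rV[R[i]]_r := \row_j (p j)%:R.
have t0 : torus t by move=> j; rewrite mxE pnatr_eq0 -lt0n prime_gt0.
pose v := monomial_map alpha t.
have v0 : torus v by exact: monomial_map_torus.
exists (diag_mx v); split.
- exact: diag_mx_is_diag.
- by rewrite unitmxE det_diag unitfE; apply/prodf_neq0 => i _; exact: v0.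
apply: zariski_closure_eq => [x [k]|q qv _ [x x0 <-]].
  (* The [k]-th power of M is the image of the [k]-th power of [t], as the monomial map is
     multiplicative. *)
  rewrite mxpowz_diag // => xv; exists (\row_j t 0 j ^ k).
    by move=> j; rewrite mxE expfz_neq0.
  rewrite monomial_map_exprz; apply/rowP => i.
  by have /matrixP/(_ i i) := xv; rewrite !mxE eqxx !mulr1n => ->.
rewrite mevalE.
apply: (sum_exp_eq0_transfer _ _ _
  (fun m : 'X_{1..n} => \prod_i v 0 i ^+ m i)) => [m m'|k].
  rewrite !monomial_map_mmap1 //.
  have tE (e : 'I_r -> int) : \prod_j t 0 j ^ e j = \prod_j (p j)%:R ^ e j.
    by apply: eq_bigr => j _; rewrite mxE.
  rewrite !tE => /prod_primes_exprz_inj-/(_ p_inj p_prime) mm'.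
  by apply: eq_bigr => j _; rewrite mm'.
(* The [k]-th power sum is the value of [q] at the [k]-th power of M; nonnegative powers suffice. *)
rewrite -[RHS](qv (\row_i v 0 i ^ Posz k)); last first.
  by exists (Posz k); rewrite mxpowz_diag.
rewrite mevalE; apply: eq_bigr => m _; congr (_ * _).
rewrite -prodrXl; apply: eq_bigr => i _.
by rewrite [in RHS]mxE -[v 0 i ^ k]/(v 0 i ^+ k) exprAC.
Qed.
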